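(* If $(X,R)$ is a wac tournament which admits a quotient map onto an arc, then $(X,R)$ has a maximum order quotient map, and it is unique up to isomorphism: if $\pi:(X,R)\to(Y,L)$ and $\pi_1:(X,R)\to(Y_1,L_1)$ are maximum order quotient maps, then there is an isomorphism $q:(Y,L)\to(Y_1,L_1)$ with $q\circ\pi=\pi_1$.
   Context: All spaces are Hausdorff. A tournament on a nonempty set $X$ is a relation $R\subset X\times X$ with $R\cap R^{-1}=1_X=\{(x,x):x\in X\}$ and $R\cup R^{-1}=X\times X$. Its set of arcs is $R^\circ=R\setminus 1_X$. It is an arc if $X$ has exactly two points. For $A\subset X$ the restriction is $R|A=R\cap(A\times A)$. $(X,R)$ is a compact topological tournament when $X$ is a compact space and $R$ is closed in $X\times X$. A 3-cycle is a triple of distinct points with $(x_1,x_2),(x_2,x_3),(x_3,x_1)\in R^\circ$. A point $x$ is a cycle point when every neighborhood of $x$ contains a 3-cycle which includes $x$. A wac tournament is a compact topological tournament in which every non-isolated point is a cycle point. For compact topological tournaments, a quotient map $h:(X_2,R_2)\to(X_1,R_1)$ is a surjective continuous map $h:X_2\to X_1$ with $(h\times h)(R_2)\subset R_1$; it is an isomorphism when it is also injective. A tournament has an arc quotient when it admits a quotient map onto an arc. A linear order is the same as a transitive tournament. If $L$ is a linear order on a finite set $Y$ with at least two points, a maximum order quotient map $h:(X,R)\to(Y,L)$ is a quotient map such that for every $y\in Y$ the restriction $(h^{-1}(y),R|h^{-1}(y))$ does not have an arc quotient. *)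

(* Defs.v *)
From mathcomp Require Import all_boot all_classical topology.

Set Implicit Arguments.
Unset Strict Implicit.
Unset Printing Implicit Defensive.

Local Open Scope classical_set_scope.
Local Open Scope card_scope.
Local Open Scope relation_scope.

Definition tournament (X : Type) (R : set (X * X)) : Prop :=
  [/\ [set: X] !=set0,
      R `&` R^-1 = diagonal
    & R `|` R^-1 = [set: X * X]].

Definition arcs (X : Type) (R : set (X * X)) : set (X * X) := R `\` diagonal.

(* [set_val] is the inclusion of the subtype [A] into [X]; the topology that
   the library puts on this subtype is the subspace topology. *)
Definition restriction (X : Type) (R : set (X * X)) (A : set X) : set (A * A) :=
  [set p | R (set_val p.1, set_val p.2)].
Arguments restriction {X} R A _.

Definition three_cycle (X : Type) (R : set (X * X)) (x1 x2 x3 : X) : Prop :=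
  [/\ x1 <> x2, x2 <> x3 & x3 <> x1] /\
  [/\ arcs R (x1, x2), arcs R (x2, x3) & arcs R (x3, x1)].

Definition compact_tournament (X : topologicalType) (R : set (X * X)) : Prop :=
  [/\ hausdorff_space X, compact [set: X], closed R & tournament R].

Definition cycle_point (X : topologicalType) (R : set (X * X)) (x : X) : Prop :=
  forall U : set X, nbhs x U ->
    exists x1 x2 x3 : X,
      [/\ three_cycle R x1 x2 x3,
          [set x1; x2; x3] `<=` U
        & [set x1; x2; x3] x].

Definition wac_tournament (X : topologicalType) (R : set (X * X)) : Prop :=
  compact_tournament R /\
  forall x : X, ~ isolated [set: X] x -> cycle_point R x.

(* Between compact Hausdorff spaces, a continuous surjection is automatically a
   topological quotient map. *)
Definition quotient_map (X2 X1 : topologicalType)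
    (R2 : set (X2 * X2)) (R1 : set (X1 * X1)) (h : X2 -> X1) : Prop :=
  [/\ range h = [set: X1],
      continuous h
    & [set (h p.1, h p.2) | p in R2] `<=` R1].

Definition isomorphism (X2 X1 : topologicalType)
    (R2 : set (X2 * X2)) (R1 : set (X1 * X1)) (h : X2 -> X1) : Prop :=
  quotient_map R2 R1 h /\ injective h.

Definition is_arc (X : topologicalType) (R : set (X * X)) : Prop :=
  compact_tournament R /\ [set: X] #= `I_2.

Definition has_arc_quotient (X : topologicalType) (R : set (X * X)) : Prop :=
  exists (Y : topologicalType) (S : set (Y * Y)) (h : X -> Y),
    is_arc S /\ quotient_map R S h.

Definition linear_order (Y : Type) (L : set (Y * Y)) : Prop :=
  tournament L /\ forall a b c : Y, L (a, b) -> L (b, c) -> L (a, c).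

(* A finite set carries the discrete topology, which is what the Hausdorff
   condition in [compact_tournament] says here. *)
Definition maximum_order_quotient_map (X Y : topologicalType)
    (R : set (X * X)) (L : set (Y * Y)) (h : X -> Y) : Prop :=
  [/\ compact_tournament L /\ linear_order L,
      finite_set [set: Y],
      `I_2 #<= [set: Y],
      quotient_map R L h
    & forall y : Y, ~ has_arc_quotient (restriction R (h @^-1` [set y]))].

(* Main.v *)
From HB Require Import structures.
Require Import Defs.
From mathcomp Require Import finmap all_boot all_classical topology.

(** Call a set U of points initial when every point of U is related to every
    point outside U.  Quotients onto arcs are the same thing as nontrivial
    clopen initial sets ([arc_quotient_separated],
    [clopen_initial_arc_quotient]).

    In a wac tournament every initial set U is clopen
    ([wac_initial_clopen]).  Indeed a boundary point x of U is not isolated;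
    since R is closed, all points of U are related to x, and x is related to
    all points outside U.  In a 3-cycle x, y, z the successor y of x would
    then lie outside U and its predecessor z in U, so the arc from y to z
    would enter U, which an initial set forbids.  So x would be neither
    isolated nor a cycle point.

    Two points are in the same block when no initial set contains exactly one
    of them.  A block is an intersection of initial sets minus a union of
    initial sets, and both of these are again initial; hence blocks are open
    and, by compactness, finite in number ([wac_finitely_many_blocks]).
    Sending each point to a representative of its block is the required
    quotient map, onto the representatives ordered by R.  Its fibers have no
    arc quotient, because an initial set of a block, together with everything
    below the block, is an initial set of the whole space
    ([block_no_arc_quotient]).

    For uniqueness, the fibers of any maximum order quotient map are exactly
    the blocks ([maximum_map_fiber]), so two such maps factor through each
    other. *)

Set Implicit Arguments.
Unset Strict Implicit.
Unset Printing Implicit Defensive.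

Local Open Scope classical_set_scope.
Local Open Scope card_scope.

(** * Tournament relations *)

Section TournamentRelation.
Context {X : Type} {R : set (X * X)}.
Hypothesis hR : tournament R.

Lemma tournament_refl x : R (x, x).
Proof.
case: hR => _ /seteqP[_ dR] _.
by case: (dR (x, x) erefl).
Qed.

Lemma tournament_anti x y : R (x, y) -> R (y, x) -> x = y.
Proof.
move=> Rxy Ryx; case: hR => _ /seteqP[dR _] _.
exact: (dR (x, y) (conj Rxy Ryx)).
Qed.

Lemma tournament_total x y : R (x, y) \/ R (y, x).
Proof. by case: hR => _ _ /seteqP[_ /(_ (x, y) I)]. Qed.

Lemma restriction_tournament (A : set X) :
  A !=set0 -> tournament (restriction R A).
Proof.
move=> [a Aa]; split; first by exists (SigSub (mem_set Aa)).
- apply/seteqP; split=> -[u v] /=.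
    by case=> Ruv Rvu; apply: val_inj; exact: tournament_anti.
  by move=> /diagonalP ->; split; exact: tournament_refl.
- by apply/seteqP; split=> // -[u v] _; exact: tournament_total.
Qed.

End TournamentRelation.

(** * Initial sets and blocks *)

Definition initial_set {X : Type} (R : set (X * X)) (U : set X) : Prop :=
  forall u v, U u -> ~ U v -> R (u, v).

Definition separated {X : Type} (R : set (X * X)) (x y : X) : Prop :=
  exists U, [/\ initial_set R U, U x & ~ U y].

Definition block {X : Type} (R : set (X * X)) (x : X) : set X :=
  [set y | ~ separated R x y /\ ~ separated R y x].

Section InitialSets.
Context {X : Type} {R : set (X * X)}.

Lemma separated_rel x y : separated R x y -> R (x, y).
Proof. by move=> [U [iU Ux Uy]]; exact: iU. Qed.

Lemma separatedNxx x : ~ separated R x x.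
Proof. by move=> [U [_]]. Qed.

Lemma block_refl x : block R x x.
Proof. by split; exact: separatedNxx. Qed.

Lemma initial_bigcup (F : set (set X)) :
  F `<=` initial_set R -> initial_set R (\bigcup_(U in F) U).
Proof.
move=> iF u v [U FU Uu] nv; apply: (iF U FU u v Uu) => Uv.
by apply: nv; exists U.
Qed.

Lemma initial_bigcap (F : set (set X)) :
  F `<=` initial_set R -> initial_set R (\bigcap_(U in F) U).
Proof.
move=> iF u v Fu /existsNP[U /not_implyP[FU Uv]].
exact: (iF U FU u v (Fu U FU) Uv).
Qed.

Lemma block_initialP x y :
  block R x y <-> forall U, initial_set R U -> (U x <-> U y).
Proof.
split=> [[nxy nyx] U iU|h].
  by split=> Ux; apply: contrapT => Uy; [apply: nxy|apply: nyx]; exists U.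
by split=> -[U [iU Ux]]; apply; apply/(h U iU).
Qed.

Lemma block_sym x y : block R x y -> block R y x.
Proof. by case. Qed.

Lemma block_eq x y : block R x y -> block R x = block R y.
Proof.
move=> /block_initialP xy; apply/seteqP; split=> z /block_initialP h;
  apply/block_initialP => U iU; move: (xy U iU) (h U iU); tauto.
Qed.

(** The block of x is the smallest initial set containing x minus the largest
    one avoiding x; this form makes blocks open as soon as initial sets are
    clopen. *)
Lemma block_diffE x :
  block R x = (\bigcap_(U in [set U | initial_set R U /\ U x]) U)
           `\` (\bigcup_(U in [set U | initial_set R U /\ ~ U x]) U).
Proof.
apply/seteqP; split=> y.
  move=> /block_initialP h; split=> [U [iU Ux]|]; first exact/(h U iU).
  by move=> [U [iU Ux] Uy]; apply: Ux; apply/(h U iU).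
move=> [capy cupy]; split=> -[U [iU Ux Uy]]; first by apply: Uy; apply: capy.
by apply: cupy; exists U.
Qed.

Hypothesis hR : tournament R.

(** A separating set must separate in the direction of the arc, since
    otherwise its initiality would reverse the arc. *)
Lemma separated_or_block x y : R (x, y) -> separated R x y \/ block R x y.
Proof.
move=> Rxy; have [|nxy] := pselect (separated R x y); first by left.
right; split=> // syx; apply: nxy.
have e := tournament_anti hR Rxy (separated_rel syx).
by rewrite -e in syx; case: (separatedNxx syx).
Qed.

(** The relation between distinct blocks is transitive: if the initial set
    that separates y from z missed x, then y would be related to x. *)
Lemma separated_trans_rel x y z :
  separated R x y -> separated R y z -> R (x, z).
Proof.
move=> sxy [V [iV Vy Vz]]; have [Vx|Vx] := pselect (V x); first exact: iV.
rewrite (tournament_anti hR (separated_rel sxy) (iV _ _ Vy Vx)).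
exact: iV.
Qed.

(** Extends an initial set B of a block to the whole tournament, by adding the
    union D of the initial sets that avoid the block.  A point v outside the
    block and outside D is missed by some initial set containing the block,
    so all of B is related to v. *)
Lemma initial_block_cut {x} {B : set X} :
  B `<=` block R x ->
  (forall u v, B u -> block R x v -> ~ B v -> R (u, v)) ->
  initial_set R ((\bigcup_(U in [set U | initial_set R U /\ ~ U x]) U) `|` B).
Proof.
set D := \bigcup_(U in _) U => Bx iB u v [Du|Bu] nv.
  have iD : initial_set R D by apply: initial_bigcup => U [].
  by apply: iD Du _ => Dv; apply: nv; left.
have [xv|xv] := pselect (block R x v).
  by apply: iB => // Bv; apply: nv; right.
(* Here v is outside the block but not in D, so it lies above the block. *)
have [C [iC Cx Cv]] : exists C, [/\ initial_set R C, C x & ~ C v].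
  apply: contrapT => h; apply: xv; rewrite block_diffE; split.
    by move=> C [iC Cx]; apply: contrapT => Cv; apply: h; exists C.
  by move=> Dv; apply: nv; left.
have Cu : C u by apply/(proj1 (block_initialP _ _) (Bx _ Bu) C iC).
exact: iC.
Qed.

End InitialSets.

(** * Initial sets and quotients onto arcs *)

(** An arc from outside the preimage into it would map to an arc of S entering
    V. *)
Lemma initial_preimage {X Y : topologicalType} {R : set (X * X)}
    {S : set (Y * Y)} {h : X -> Y} {V : set Y} :
  tournament R -> tournament S -> quotient_map R S h ->
  initial_set S V -> initial_set R (h @^-1` V).
Proof.
move=> hR hS [_ _ hRS] iV u v Vu Vv.
have [//|Rvu] := tournament_total hR u v.
have Svu : S (h v, h u) by apply: hRS; exists (v, u).
by case: (Vv); rewrite /preimage/= (tournament_anti hS Svu (iV _ _ Vu Vv)).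
Qed.

Lemma locally_constant_continuous {X Y : topologicalType} {f : X -> Y} :
  (forall x, exists2 V, nbhs x V & forall y, V y -> f y = f x) -> continuous f.
Proof.
move=> lc; apply/continuousP => A _; rewrite openE => x Afx.
by have [V Vx fV] := lc x; apply: filterS Vx => y /fV; rewrite /preimage/= => ->.
Qed.

Lemma injective_continuous_hausdorff {X Y : topologicalType} {f : X -> Y} :
  injective f -> continuous f -> hausdorff_space Y -> hausdorff_space X.
Proof.
move=> finj fc hY p q pq; apply/finj/hY => A B /fc fA /fc fB.
by have [z [Az Bz]] := pq _ _ fA fB; exists (f z).
Qed.

Lemma finite_hausdorff_open {Y : topologicalType} (A : set Y) :
  hausdorff_space Y -> finite_set [set: Y] -> open A.
Proof.
move=> hY fY; rewrite -closedC.
apply: (proj1 accessible_finite_set_closed (hausdorff_accessible hY)).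
exact: sub_finite_set fY.
Qed.

(** In the product, every singleton is a neighborhood of its point. *)
Lemma finite_hausdorff_closed_rel {Y : topologicalType} (L : set (Y * Y)) :
  hausdorff_space Y -> finite_set [set: Y] -> closed L.
Proof.
move=> hY fY; rewrite -openC openE => -[a b] nL.
exists ([set a], [set b]).
  by split; apply: open_nbhs_nbhs; split=> //; exact: finite_hausdorff_open.
by move=> [c d] /= [-> ->].
Qed.

Lemma finite_compact_tournament {Y : topologicalType} (L : set (Y * Y)) :
  hausdorff_space Y -> finite_set [set: Y] -> tournament L ->
  compact_tournament L.
Proof.
move=> hY fY tL; split=> //; first exact: finite_compact.
exact: finite_hausdorff_closed_rel.
Qed.

Lemma two_points_card {T : Type} (a b : T) : a <> b -> `I_2 #<= [set: T].
Proof.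
move=> ab; pose f n := if n is 0 then a else b.
have finj : {in `I_2 &, injective f}.
  move=> [|[|m]] [|[|n]]; rewrite !inE//= => _ _ //.
  by move=> /esym.
move: (inj_card_eq finj) => /card_eqPle[_ h].
by apply: card_le_trans h _; exact: subset_card_le.
Qed.

(** The initial set is the source of the only arc. *)
Lemma is_arc_initial {Y : topologicalType} {S : set (Y * Y)} :
  is_arc S -> exists a b, a <> b /\ initial_set S [set a].
Proof.
move=> [[_ _ _ tS] /card_set_bijP[f [ffun finj fsurj]]].
have inj u v : f u = f v -> u = v by move=> e; apply: finj e; rewrite inE.
have [/= a _ fa] := fsurj 0 isT; have [/= b _ fb] := fsurj 1 isT.
have ab : a <> b by move=> e; move: fb; rewrite -e fa.
have cover y : y = a \/ y = b.
  have : `I_2 (f y) by apply: ffun.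
  by case E : (f y) => [|[|//]] _; [left|right]; apply: inj; rewrite E.
have [Sab|Sba] := tournament_total tS a b.
  by exists a, b; split=> // u v /= -> ; case: (cover v) => ->.
exists b, a; split=> [/esym//|u v /= ->]; by case: (cover v) => ->.
Qed.

Lemma arc_quotient_separated {X : topologicalType} {R : set (X * X)} :
  tournament R -> has_arc_quotient R -> exists x y, separated R x y.
Proof.
move=> tR [Y [S [h [aS qh]]]].
have [a [b [ab ia]]] := is_arc_initial aS.
have [hsurj _ _] := qh; have tS : tournament S by case: aS => -[].
have [[x _ hx] [y _ hy]] : range h a /\ range h b by rewrite hsurj.
exists x, y, (h @^-1` [set a]); split=> //; first exact: initial_preimage ia.
by rewrite /preimage/= hy => /esym.
Qed.

(** The arc from [false] to [true], on the discrete space of booleans. *)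
Definition bool_le : set (bool * bool) := [set p | p.1 ==> p.2].

Lemma bool_le_is_arc : is_arc bool_le.
Proof.
split.
  apply: finite_compact_tournament; first exact: discrete_hausdorff.
    exact: finite_finset.
  split; first by exists true.
    by apply/seteqP; split=> -[[] []] //= [].
  by apply/seteqP; split=> -[[] []] //= _; [left|right|left|left].
have finj : {in `I_2 &, injective (fun n => n == 1)}.
  by move=> [|[|m]] [|[|n]]; rewrite !inE.
suff -> : [set: bool] = (fun n => n == 1) @` `I_2 by exact: inj_card_eq.
by apply/seteqP; split=> // -[] _; [exists 1|exists 0].
Qed.

(** U is sent to [false], the source of the arc, and its complement to
    [true]. *)
Lemma clopen_initial_arc_quotient {X : topologicalType} {R : set (X * X)}
    {U : set X} {x y : X} :
  tournament R -> clopen U -> initial_set R U -> U x -> ~ U y ->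
  has_arc_quotient R.
Proof.
move=> tR [oU cU] iU Ux Uy.
exists bool, bool_le, (fun z => ~~ `[< U z >]).
split; first exact: bool_le_is_arc.
split.
- apply/seteqP; split=> // -[] _; [exists y|exists x] => //.
    by rewrite asboolF.
  by rewrite asboolT.
- apply: locally_constant_continuous => z; have [Uz|Uz] := pselect (U z).
    exists U; first exact: open_nbhs_nbhs.
    by move=> w Uw; rewrite !asboolT.
  exists (~` U); first by apply: open_nbhs_nbhs; split=> //; exact: closed_openC.
  by move=> w Uw; rewrite !asboolF.
- move=> _ [[u v] /= Ruv <-]; rewrite /bool_le/=.
  apply/implyP => /asboolPn Uu; apply/asboolPn => Uv; case: (Uu).
  by rewrite (tournament_anti tR Ruv (iU _ _ Uv Uu)).
Qed.

(** * Wac tournaments *)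

Lemma closed_rel_closure_l {X : topologicalType} {R : set (X * X)}
    {A : set X} {x y : X} :
  closed R -> closure A x -> (forall a, A a -> R (a, y)) -> R (x, y).
Proof.
move=> cR clA Ay.
have cf : continuous (fun z : X => (z, y)).
  by move=> z; apply: (cvg_pair cvg_id); exact: cvg_cst.
have /closure_id clR : closed ((fun z => (z, y)) @^-1` R).
  by move/continuous_closedP: cf; apply.
by have := closureS Ay clA; rewrite -clR.
Qed.

Lemma closed_rel_closure_r {X : topologicalType} {R : set (X * X)}
    {A : set X} {x y : X} :
  closed R -> closure A x -> (forall a, A a -> R (y, a)) -> R (y, x).
Proof.
move=> cR clA Ay.
have cf : continuous (fun z : X => (y, z)).
  by move=> z; apply: cvg_pair => //; exact: cvg_cst.
have /closure_id clR : closed ((fun z => (y, z)) @^-1` R).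
  by move/continuous_closedP: cf; apply.
by have := closureS Ay clA; rewrite -clR.
Qed.

Lemma three_cycle_at {X : Type} {R : set (X * X)} {x1 x2 x3 x : X} :
  three_cycle R x1 x2 x3 -> [set x1; x2; x3] x ->
  exists y z, [/\ arcs R (x, y), arcs R (y, z) & arcs R (z, x)].
Proof.
move=> [_ [a12 a23 a31]] [[->|->]|->].
- by exists x2, x3.
- by exists x3, x1.
- by exists x1, x2.
Qed.

Section Wac.
Context {X : topologicalType} {R : set (X * X)}.
Hypothesis hwac : wac_tournament R.

Let tR : tournament R. Proof. by case: hwac => -[]. Qed.

(** A boundary point of an initial set lies above the set and below its
    complement, so no 3-cycle passes through it; being a limit point, it
    cannot be isolated either. *)
Lemma wac_initial_boundary U x :
  initial_set R U -> closure U x -> ~ closure (~` U) x.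
Proof.
move=> iU Ux Cx; have cR : closed R by case: hwac => -[].
have below y : U y -> R (y, x).
  by move=> Uy; apply: (closed_rel_closure_r cR Cx) => a; exact: iU.
have above y : ~ U y -> R (x, y).
  by move=> Uy; apply: (closed_rel_closure_l cR Ux) => a /iU; exact.
have niso : ~ isolated [set: X] x.
  move=> [_ [V Vx]]; rewrite setIT => eV.
  have [u [Uu Vu]] := Ux _ Vx; have [v [Uv Vv]] := Cx _ Vx.
  by move: Vu Vv; rewrite eV => /= eu ev; rewrite ev -eu in Uv.
have [_ /(_ x niso)/(_ setT filterT)[x1 [x2 [x3 [c3 _ xc]]]]] := hwac.
have [y [z [[Rxy xy] [Ryz yz] [Rzx zx]]]] := three_cycle_at c3 xc.
(* The successor y of x is outside U and its predecessor z is in U, so the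
   arc from y to z enters U. *)
have [Uy|Uy] := pselect (U y).
  by apply: xy; exact: (tournament_anti tR Rxy (below _ Uy)).
have [Uz|Uz] := pselect (U z).
  by apply: yz; exact: (tournament_anti tR Ryz (iU _ _ Uz Uy)).
by apply: zx; exact: (tournament_anti tR Rzx (above _ Uz)).
Qed.

Lemma wac_initial_clopen U : initial_set R U -> clopen U.
Proof.
move=> iU; split.
  rewrite -closedC; apply/closure_id/seteqP; split; first exact: subset_closure.
  by move=> x Cx Ux; apply: (wac_initial_boundary iU _ Cx); exact: subset_closure.
apply/closure_id/seteqP; split; first exact: subset_closure.
move=> x Ux; apply: contrapT => Cx.
by apply: (wac_initial_boundary iU Ux); exact: subset_closure.
Qed.

Lemma wac_block_open x : open (block R x).
Proof.
rewrite block_diffE setDE; apply: openI.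
  by apply: (proj1 (wac_initial_clopen _)); apply: initial_bigcap => U [].
apply: closed_openC; apply: (proj2 (wac_initial_clopen _)).
by apply: initial_bigcup => U [].
Qed.

Lemma wac_finitely_many_blocks :
  exists2 D : set X, finite_set D & forall x, exists2 d, D d & block R d x.
Proof.
have [[_ cX _ [[x0 _] _ _]] _] := hwac.
(* Compactness by open covers is stated for pointed spaces. *)
pose pX : ptopologicalType := HB.pack X (isPointed.Build X x0).
have : @compact pX setT by []; rewrite compact_cover => {}cX.
have [||D _ cD] := cX pX setT (block R).
- by move=> x _; exact: wac_block_open.
- by move=> x _; exists x => //; exact: block_refl.
- by exists [set` D]; [exact: finite_fset|move=> x; exact: cD].
Qed.

Lemma block_constant_continuous {Z : topologicalType} {f : X -> Z} :
  (forall x y, block R x y -> f x = f y) -> continuous f.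
Proof.
move=> fc; apply: locally_constant_continuous => x; exists (block R x).
  by apply: open_nbhs_nbhs; split; [exact: wac_block_open|exact: block_refl].
by move=> y /fc.
Qed.

(** An arc quotient of a block would give an initial set of the block
    containing some u but not v; its extension to the whole tournament would
    separate u from v, which lie in the same block. *)
Lemma block_no_arc_quotient x : ~ has_arc_quotient (restriction R (block R x)).
Proof.
move=> aq; have tB : tournament (restriction R (block R x)).
  by apply: (restriction_tournament tR); exists x; exact: block_refl.
have [u [v [B [iB Bu Bv]]]] := arc_quotient_separated tB aq.
pose B' : set X := set_val @` B.
have mem (w : block R x) : B' (set_val w) -> B w by move=> [w' Bw' /val_inj <-].
have B'x : B' `<=` block R x by move=> _ [w _ <-]; exact: set_valP.
have iB' a b : B' a -> block R x b -> ~ B' b -> R (a, b).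
  move=> [w Bw <-] xb nb; apply: (iB w (SigSub (mem_set xb))) => // Bb.
  by apply: nb; exists (SigSub (mem_set xb)).
have iU := initial_block_cut B'x iB'; set U := (_ `|` B') in iU.
have xu : block R x (set_val u) by exact: set_valP.
have xv : block R x (set_val v) by exact: set_valP.
have xuv : block R (set_val u) (set_val v) by rewrite -(block_eq xu).
have /(proj1 (block_initialP _ _) xuv U iU) : U (set_val u) by right; exists u.
move=> [[C [iC Cx] Cv]|/mem//].
by apply: Cx; apply/(proj1 (block_initialP _ _) xv C iC).
Qed.

End Wac.

(** * Maximum order quotient maps *)

Section MaximumMap.
Context {X Y : topologicalType} {R : set (X * X)} {L : set (Y * Y)}.
Context (pi : X -> Y).
Hypotheses (hwac : wac_tournament R) (hpi : maximum_order_quotient_map R L pi).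

Lemma maximum_map_open (A : set Y) : open A.
Proof. by case: hpi => -[[hY _ _ _] _] fY _ _ _; exact: finite_hausdorff_open. Qed.

Lemma maximum_map_surj y : exists x, pi x = y.
Proof.
case: hpi => _ _ _ [s _ _] _.
by have [x _ <-] : range pi y by [rewrite s]; exists x.
Qed.

(** If an initial set separated two points of one fiber, its trace on that
    fiber would be a nontrivial clopen initial set, and the fiber would have
    an arc quotient. *)
Lemma maximum_map_same_block x y : pi x = pi y -> block R x y.
Proof.
suff nsep u v : pi u = pi v -> ~ separated R u v by split; apply: nsep.
have [[_ _ _ tR] _] := hwac.
case: hpi => _ _ _ _ /(_ (pi v)) noarc puv [U [iU Uu Uv]]; apply: noarc.
have Fv : (pi @^-1` [set pi v]) v by [].
have Fu : (pi @^-1` [set pi v]) u by [].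
set F := pi @^-1` _ in Fv Fu *.
have cU : clopen (set_val @^-1` U : set F).
  have [oU cU] := wac_initial_clopen hwac iU.
  have cv : continuous (set_val : F -> X) := @initial_continuous F X set_val.
  by split; [move/continuousP : cv|move/continuous_closedP : cv]; apply.
apply: (@clopen_initial_arc_quotient _ _ (set_val @^-1` U)
  (SigSub (mem_set Fu)) (SigSub (mem_set Fv))) => //.
  by apply: (restriction_tournament tR); exists v.
by move=> a b; exact: iU.
Qed.

(** The separating set is the preimage of the set of points of Y below or
    equal to pi x, an initial set because L is transitive. *)
Lemma maximum_map_separated x y :
  L (pi x, pi y) -> pi x <> pi y -> separated R x y.
Proof.
have [[_ _ _ tR] _] := hwac; case: hpi => -[_ [tL trL]] _ _ qpi _ Lxy nxy.
exists (pi @^-1` [set b | L (b, pi x)]); split.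
- apply: (initial_preimage tR tL qpi) => a b /= Lax nLbx.
  by case: (tournament_total tL a b) => // /trL/(_ Lax).
- exact: tournament_refl.
- by move=> /(tournament_anti tL Lxy).
Qed.

Lemma maximum_map_fiber x y : pi x = pi y <-> block R x y.
Proof.
split; first exact: maximum_map_same_block.
move=> [nxy nyx]; apply: contrapT => nE.
have tL : tournament L by case: hpi => -[_ []].
have [h|h] := tournament_total tL (pi x) (pi y).
  exact/nxy/maximum_map_separated.
by apply/nyx/maximum_map_separated => // /esym.
Qed.

End MaximumMap.

(** The quotient is realized inside X, as the subspace of a set of
    representatives of the blocks: it then inherits from X both the Hausdorff
    property and the tournament relation. *)
Lemma maximum_map_exists {X : topologicalType} {R : set (X * X)} :
  wac_tournament R -> has_arc_quotient R ->
  exists (Y : topologicalType) (L : set (Y * Y)) (pi : X -> Y),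
    maximum_order_quotient_map R L pi.
Proof.
move=> hwac harc; have [[hX _ _ tR] _] := hwac.
have [x0 _] : [set: X] !=set0 by case: tR.
pose r x := xget x0 (block R x).
have rP x : block R x (r x) by apply: xgetPex; exists x; exact: block_refl.
have r_eq x y : block R x y -> r x = r y by move=> xy; rewrite /r (block_eq xy).
have r_blk x y : r x = r y -> block R x y.
  by move=> e; rewrite (block_eq (rP x)) e; apply/block_sym/rP.
pose Y : set X := range r.
have Yr x : Y (r x) by exists x.
pose pi x : Y := SigSub (mem_set (Yr x)).
have pi_eq x y : pi x = pi y <-> block R x y.
  split=> [/(congr1 set_val)/r_blk//|/r_eq e]; exact: val_inj.
have pi_surj y : exists x, pi x = y.
  by have [x _ rx] := set_valP y; exists x; apply: val_inj.
have blkY (a b : Y) : block R (set_val a) (set_val b) -> a = b.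
  have [x <-] := pi_surj a; have [y <-] := pi_surj b => /= xy; apply/pi_eq.
  by rewrite (block_eq (rP x)) (block_eq xy); apply/block_sym/rP.
have piL x y : R (x, y) -> restriction R Y (pi x, pi y).
  move=> Rxy; have [sxy|xy] := separated_or_block tR Rxy.
    case: sxy => U [iU Ux Uy]; apply: (iU).
      exact/(proj1 (block_initialP _ _) (rP x) U iU).
    by move=> Ury; apply: Uy; apply/(proj1 (block_initialP _ _) (rP y) U iU).
  by rewrite (proj2 (pi_eq x y) xy); exact: (tournament_refl tR).
exists Y, (restriction R Y), pi.
have hY : hausdorff_space Y.
  have vc : continuous (set_val : Y -> X) := @initial_continuous Y X set_val.
  by apply: (injective_continuous_hausdorff _ vc hX) => a b; exact: val_inj.
have fY : finite_set [set: Y].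
  have [D fD cD] := wac_finitely_many_blocks hwac.
  apply: (@sub_finite_set _ _ (pi @` D)); last exact: finite_image.
  move=> y _; have [x <-] := pi_surj y; have [d Dd dx] := cD x.
  by exists d => //; apply/pi_eq.
have tY : tournament (restriction R Y).
  by apply: (restriction_tournament tR); exists (r x0).
split=> //.
- split; first exact: finite_compact_tournament.
  split=> // a b c; rewrite /restriction/= => Rab Rbc.
  have [sab|/blkY ->//] := separated_or_block tR Rab.
  have [sbc|/blkY <-//] := separated_or_block tR Rbc.
  exact: (separated_trans_rel tR sab sbc).
- have [x [y sxy]] := arc_quotient_separated tR harc.
  by apply: (@two_points_card _ (pi x) (pi y)) => /pi_eq[].
- split.
  + by apply/seteqP; split=> // y _; have [x <-] := pi_surj y; exists x.
  + by apply: (block_constant_continuous hwac) => x y /pi_eq.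
  + by move=> _ [[x y] /= Rxy <-]; exact: piL.
- move=> y; have [x <-] := pi_surj y.
  have -> : pi @^-1` [set pi x] = block R x.
    by apply/seteqP; split=> z /=; [move=> /esym /pi_eq|move=> /pi_eq/esym].
  exact: block_no_arc_quotient.
Qed.

Theorem mainTheorem6 (X : topologicalType) (R : set (X * X))
    (hwac : wac_tournament R) (harc : has_arc_quotient R) :
  (exists (Y : topologicalType) (L : set (Y * Y)) (pi : X -> Y),
     maximum_order_quotient_map R L pi) /\
  (forall (Y Y1 : topologicalType) (L : set (Y * Y)) (L1 : set (Y1 * Y1))
          (pi : X -> Y) (pi1 : X -> Y1),
     maximum_order_quotient_map R L pi ->
     maximum_order_quotient_map R L1 pi1 ->
     exists q : Y -> Y1, isomorphism L L1 q /\ q \o pi = pi1).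
Proof.
split; first exact: maximum_map_exists.
move=> Y Y1 L L1 pi pi1 hpi hpi1.
have [s sK] := choice (maximum_map_surj hpi).
have same x y : pi x = pi y <-> pi1 x = pi1 y.
  by rewrite (maximum_map_fiber hwac hpi) (maximum_map_fiber hwac hpi1).
have qpi x : pi1 (s (pi x)) = pi1 x by apply/same/sK.
exists (pi1 \o s); split; last by apply/funext.
split; last by move=> a b /same; rewrite !sK.
have [_ _ _ [_ _ piL] _] := hpi; have [_ _ _ [_ _ pi1L] _] := hpi1.
have [[_ [tL _]] _ _ _ _] := hpi; have [[_ [tL1 _]] _ _ _ _] := hpi1.
have [[_ _ _ tR] _] := hwac.
split.
- apply/seteqP; split=> // y _; have [x <-] := maximum_map_surj hpi1 y.
  by exists (pi x) => //=; exact: qpi.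
- by apply/continuousP => A _; exact: (maximum_map_open hpi).
- move=> _ [[a b] /= Lab <-].
  have [Rab|Rba] := tournament_total tR (s a) (s b).
    by apply: pi1L; exists (s a, s b).
  have Lba : L (b, a) by apply: piL; exists (s b, s a) => //=; rewrite !sK.
  by rewrite (tournament_anti tL Lab Lba); exact: tournament_refl.
Qed.
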